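(* If $G$ is a connected, locally isometric graph with maximum degree $\Delta(G)=6$ such that $G$ contains no true twins of degree $6$, then $G$ is either fully cycle extendable or isomorphic to $K_{2,4}+K_1$.
   Context: All graphs are finite and simple. For a vertex $v$, $N(v)$ is its open neighbourhood, $N[v]=N(v)\cup\{v\}$, and $\langle N(v)\rangle$ is the subgraph induced by $N(v)$. A graph $G$ is locally isometric if for every vertex $v$ the graph $\langle N(v)\rangle$ has diameter at most $2$, i.e. any two vertices of $\langle N(v)\rangle$ are at distance at most $2$ in $\langle N(v)\rangle$ (in particular $\langle N(v)\rangle$ is connected). Two distinct vertices $u,v$ are true twins if $N[u]=N[v]$. The join $G+H$ of vertex disjoint graphs is obtained from their union by adding all edges between $V(G)$ and $V(H)$. A cycle $C$ in $G$ is extendable if there is a cycle $C'$ in $G$ whose vertex set is $V(C)$ together with exactly one additional vertex. $G$ is fully cycle extendable if every nonhamiltonian cycle of $G$ is extendable and every vertex of $G$ lies on a $3$-cycle. *)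

(* Defs.v *)
From mathcomp Require Import all_boot.

Set Implicit Arguments.
Unset Strict Implicit.
Unset Printing Implicit Defensive.

Record sgraph := SGraph {
  vertex :> finType;
  adj : rel vertex;
  adj_sym : symmetric adj;
  adj_irrefl : irreflexive adj
}.

Section Graph.
Variable G : sgraph.
Implicit Types (u v x y : G) (A : {set G}) (c : seq G).

Definition nbhd v : {set G} := [set u | adj v u].
Definition cnbhd v : {set G} := v |: nbhd v.
Definition deg v : nat := #|nbhd v|.
Definition max_deg : nat := \max_(v : G) deg v.

Definition connected : Prop := forall x y, connect (@adj G) x y.

Definition true_twins u v : Prop := u <> v /\ cnbhd u = cnbhd v.

Definition dist_le x y (k : nat) : Prop :=
  exists p : seq G, [/\ path (@adj G) x p, last x p = y & size p <= k].

Definition diam_le (k : nat) : Prop := forall x y, dist_le x y k.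

(* A cycle is the sequence of its vertices in cyclic order; [ucycle] alone
   would also accept the empty sequence and a single edge traversed twice. *)
Definition is_cycle c : Prop := ucycle (@adj G) c /\ 3 <= size c.

Definition hamiltonian c : Prop := forall x, x \in c.

Definition extendable c : Prop :=
  exists (x : G) (c' : seq G),
    [/\ x \notin c, is_cycle c' & [set y in c'] = x |: [set y in c]].

Definition fully_cycle_extendable : Prop :=
  (forall c, is_cycle c -> ~ hamiltonian c -> extendable c) /\
  (forall v, exists c, [/\ is_cycle c, size c = 3 & v \in c]).

Section Induced.
Variable A : {set G}.
Definition induced_adj : rel {x : G | x \in A} :=
  fun a b => adj (val a) (val b).
Lemma induced_adj_sym : symmetric induced_adj.
Proof. by move=> a b; apply: adj_sym. Qed.
Lemma induced_adj_irrefl : irreflexive induced_adj.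
Proof. by move=> a; apply: adj_irrefl. Qed.
Definition induced : sgraph := SGraph induced_adj_sym induced_adj_irrefl.
End Induced.

End Graph.

Definition locally_isometric (G : sgraph) : Prop :=
  forall v : G, diam_le (induced (nbhd v)) 2.

Section Join.
Variables G H : sgraph.
Definition join_adj : rel (G + H)%type := fun x y =>
  match x, y with
  | inl a, inl b => adj a b
  | inr a, inr b => adj a b
  | _, _ => true
  end.
Lemma join_adj_sym : symmetric join_adj.
Proof. by move=> [a|a] [b|b] //=; apply: adj_sym. Qed.
Lemma join_adj_irrefl : irreflexive join_adj.
Proof. by move=> [a|a] /=; apply: adj_irrefl. Qed.
Definition join : sgraph := SGraph join_adj_sym join_adj_irrefl.
End Join.

Section Complete.
Variable n : nat.
Definition complete_adj : rel 'I_n := fun x y => x != y.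
Lemma complete_adj_sym : symmetric complete_adj.
Proof. by move=> x y; rewrite /complete_adj eq_sym. Qed.
Lemma complete_adj_irrefl : irreflexive complete_adj.
Proof. by move=> x; rewrite /complete_adj eqxx. Qed.
Definition complete : sgraph := SGraph complete_adj_sym complete_adj_irrefl.
End Complete.

Section CompleteBipartite.
Variables m n : nat.
Definition complete_bipartite_adj : rel ('I_m + 'I_n)%type := fun x y =>
  match x, y with
  | inl _, inr _ | inr _, inl _ => true
  | _, _ => false
  end.
Lemma complete_bipartite_adj_sym : symmetric complete_bipartite_adj.
Proof. by move=> [a|a] [b|b]. Qed.
Lemma complete_bipartite_adj_irrefl : irreflexive complete_bipartite_adj.
Proof. by case. Qed.
Definition complete_bipartite : sgraph :=
  SGraph complete_bipartite_adj_sym complete_bipartite_adj_irrefl.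
End CompleteBipartite.

Definition isomorphic (G H : sgraph) : Prop :=
  exists f : G -> H, bijective f /\ forall x y, adj (f x) (f y) = adj x y.

(* Main.v *)
Require Import Defs.
From mathcomp Require Import all_boot.

(* Let C be a nonhamiltonian cycle. By connectivity some x off C is adjacent
   to some v on C. Start from x, v and the two neighbours of v on C, and
   repeatedly split into cases: whether two named vertices are adjacent, which
   vertex is a common neighbour of two nonadjacent neighbours of a named
   vertex (it exists by local isometry), whether a named vertex has further
   neighbours, and how the named vertices are placed along C. With at most ten
   named vertices every branch ends in one of these ways: an extension of C is
   visible, the neighbours found so far contradict local isometry, there are
   true twins of degree 6, the graph is K_{2,4} + K_1, or a set of vertices of
   degree at most 5 is attached to the rest through two adjacent vertices with
   the same two neighbours inside it. The last situation propagates through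
   the whole graph and excludes a vertex of degree 6, see [strip_deg]. The
   case distinction [cases] was found by a computer search; it is replayed by
   the checker [refutes]. *)

Set Implicit Arguments.
Unset Strict Implicit.
Unset Printing Implicit Defensive.

(** * Local structure *)

Section LocalStructure.
Variable G : sgraph.
Hypothesis Gconn : connected G.
Hypothesis Gloc : locally_isometric G.
Implicit Types (u v w a b p q x : G) (B : {set G}).

Lemma adjC u v : adj u v = adj v u.
Proof. exact: adj_sym. Qed.

Lemma adj_neq u v : adj u v -> u != v.
Proof. by apply: contraTneq => ->; rewrite adj_irrefl. Qed.

(** A path of length at most 2 from [a] to [b] inside the neighbourhood of [v] cannot have length 0
    or 1 here, so it has a middle vertex. This is the form in which local isometry is used
    everywhere below. *)
Lemma common_neighbour v a b :
  adj v a -> adj v b -> a != b -> ~~ adj a b ->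
  exists w, [/\ adj v w, adj a w & adj b w].
Proof.
move=> va vb ab nab.
have ain : a \in nbhd v by rewrite inE.
have bin : b \in nbhd v by rewrite inE.
case: (Gloc (Sub a ain : induced (nbhd v)) (Sub b bin)) => -[|y [|z [|? ?]]] [] yp yl // _.
- by move/(congr1 val): yl => /= eab; rewrite eab eqxx in ab.
- by move: yp nab; rewrite -[last _ _]/y in yl; rewrite yl /= andbT /induced_adj /= => ->.
exists (val y); move: (valP y) yp; rewrite inE -[last _ _]/z in yl *.
rewrite yl /= /induced_adj /= andbT => -> /andP[ay yb].
by split=> //; rewrite adjC.
Qed.

Lemma closed_set_full B x : x \in B ->
  (forall u v, u \in B -> adj u v -> v \in B) -> forall y, y \in B.
Proof.
move=> xB Bcl y; have /connectP[s] := Gconn x y.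
elim: s x xB => [|z s IHs] x xB /=; first by move=> _ ->.
by case/andP=> xz; apply: IHs; apply: Bcl xz.
Qed.

Lemma deg_le_max v : deg v <= max_deg G.
Proof. exact: (leq_bigmax v). Qed.

(** Let [a] be a neighbour of [v]. If [a] has another neighbour [b], then either [b] closes a
    triangle with [v] and [a], or the common neighbour of [v] and [b] within the neighbourhood of
    [a] does. Otherwise local isometry at [v] leaves [a] as the only neighbour of [v], and the whole
    graph is one edge. *)
Lemma mem_triangle : 1 < max_deg G ->
  forall v : G, exists c, [/\ is_cycle c, size c = 3 & v \in c].
Proof.
move=> G2 v.
have triangle a b : adj v a -> adj v b -> adj a b ->
    exists c, [/\ is_cycle c, size c = 3 & v \in c].
  move=> va vb ab; exists [:: v; a; b]; split; rewrite ?inE ?eqxx //.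
  by split=> //; rewrite /ucycle /= va ab adjC vb !inE negb_or !adj_neq.
have [u deg_u] : exists u : G, 1 < deg u.
  apply/existsP; apply: contraTT G2; rewrite negb_exists -leqNgt => /forallP degG.
  by apply/bigmax_leqP => u _; rewrite leqNgt.
have [a va] : exists a, adj v a.
  have [->|vu] := eqVneq v u.
    by have /ltnW/card_gt0P[a] := deg_u; rewrite inE; exists a.
  have /connectP[[|a s] /=] := Gconn v u; last by case/andP=> va; exists a.
  by move=> _ /esym/eqP; rewrite (negPf vu).
have [/existsP[b /andP[ab bv]]|] := boolP [exists b, adj a b && (b != v)].
  have [vb|vb] := boolP (adj v b); first exact: triangle va vb ab.
  have av : adj a v by rewrite adjC.
  have vNb : v != b by rewrite eq_sym.
  have [w [aw vw _]] := common_neighbour av ab vNb vb.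
  exact: triangle va vw aw.
rewrite negb_exists => /forallP Na.
have {}Na b : adj a b -> b = v.
  by move=> ab; have := Na b; rewrite ab negbK => /eqP.
have Nv b : adj v b -> b = a.
  move=> vb; have [//|ba] := eqVneq b a.
  have [ab|ab] := boolP (adj b a); first by rewrite (Na b) ?adj_irrefl // adjC in vb.
  have [w [vw _ aw]] := common_neighbour vb va ba ab.
  by rewrite (Na w aw) adj_irrefl in vw.
have av_full : forall y, y \in [set a; v].
  apply: (closed_set_full (x := v)) => [|x y]; first by rewrite set22.
  by case/set2P=> -> => [/Na|/Nv] ->; rewrite ?set21 ?set22.
have /card_gt1P[x [y [ux uy /eqP[]]]] := deg_u; rewrite !inE in ux uy.
by case/set2P: (av_full u) => uE; rewrite uE in ux uy;
  [rewrite (Na x ux) (Na y uy) | rewrite (Nv x ux) (Nv y uy)].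
Qed.

Hypothesis Gmax : forall v, deg v <= 6.
Hypothesis Gtwins :
  ~ exists u v : G, [/\ true_twins u v, deg u = 6 & deg v = 6].

Lemma cnbhd_card v : #|cnbhd v| = (deg v).+1.
Proof. by rewrite cardsU1 inE adj_irrefl. Qed.

Lemma twins_deg u v : u != v -> cnbhd u = cnbhd v -> deg u <= 5.
Proof.
move=> uv Nuv; have duv : deg u = deg v.
  by apply: succn_inj; rewrite -!cnbhd_card Nuv.
rewrite -ltnS ltn_neqAle Gmax andbT; apply/eqP=> du; apply: Gtwins.
by exists u, v; split; [split=> //; apply/eqP|..]; rewrite -?duv.
Qed.

(* [a] and [b] have the same neighbours outside [B] too, so they are true twins
   and there are at most two such neighbours. Either these have no further
   neighbour, or they are adjacent and take over the role of [a] and [b]. *)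
Lemma strip_deg B a b p q :
    adj a b -> a \notin B -> b \notin B -> p != q ->
    nbhd a :&: B = [set p; q] -> nbhd b :&: B = [set p; q] ->
    (forall u, u \in B -> deg u <= 5) ->
    (forall u v, u \in B -> adj u v -> [|| v == a, v == b | v \in B]) ->
  forall x, deg x <= 5.
Proof.
have [n] := ubnP #|~: B|; elim: n => // n IHn in B a b p q *.
rewrite ltnS => leBn ab aB bB pq aBpq bBpq degB NB.
have inter c r : nbhd c :&: B = [set p; q] -> r \in [set p; q] -> adj c r /\ r \in B.
  by move=> <- /setIP[]; rewrite inE.
have [ap pB] := inter a p aBpq (set21 _ _).
have [bp _] := inter b p bBpq (set21 _ _).
(* The vertices [p] and [m] are nonadjacent neighbours of [c]. Their common neighbour is adjacent to
   [p], so it is [d] or lies in [B]; the latter would put [m] among the neighbours of [B]. *)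
have sideP c d m : adj c d -> adj c p ->
    (forall u v, u \in B -> adj u v -> [|| v == c, v == d | v \in B]) ->
    adj c m -> m != d -> m \notin B -> adj d m.
  move=> cd cp NB' cm md mB.
  have mc : m != c by rewrite eq_sym adj_neq.
  have pm : p != m by apply: contraNneq mB => <-.
  have npm : ~~ adj p m by apply: contra mB => /(NB' _ _ pB); rewrite (negPf mc) (negPf md).
  have [w [cw pw mw]] := common_neighbour cp cm pm npm.
  case/or3P: (NB' p w pB pw) => [/eqP wc|/eqP <-|wB]; first by rewrite wc adj_irrefl in cw.
    by rewrite adjC.
  by have := NB' w m wB; rewrite adjC mw (negPf mc) (negPf md) (negPf mB) => /(_ isT).
pose L := nbhd a :\: (b |: B).
have LP l : (l \in L) = [&& adj a l, l != b & l \notin B].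
  by rewrite !inE negb_or andbC andbA.
have LPb l : l \in L = [&& adj b l, l != a & l \notin B].
  rewrite LP; apply/and3P/and3P=> -[xl ly lB]; split=> //.
  - exact: sideP ab ap NB xl ly lB.
  - by rewrite eq_sym adj_neq.
  - apply: (sideP b) => //; first by rewrite adjC.
    by move=> u v uB /(NB _ _ uB); rewrite orbCA.
  - by rewrite eq_sym adj_neq.
have Na : nbhd a = b |: (L :|: [set p; q]).
  apply/setP=> l; rewrite -aBpq !inE; case: eqVneq => [->|lb] /=; first by rewrite ab.
  by case: (l \in B); rewrite /= ?andbF ?andbT ?orbF.
have Nb : nbhd b = a |: (L :|: [set p; q]).
  apply/setP=> l; rewrite -bBpq !(in_setU1, in_setU, in_setI) LPb !inE.
  case: eqVneq => [->|la] /=; first by rewrite adjC ab.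
  by case: (l \in B); rewrite /= ?andbF ?andbT ?orbF.
have NabE : cnbhd a = cnbhd b by rewrite /cnbhd Na Nb setUCA.
have aNb := adj_neq ab.
have deg_a := twins_deg aNb NabE.
have deg_b : deg b <= 5 by apply: twins_deg (esym NabE); rewrite eq_sym.
have LB l : l \in L -> l \notin B by rewrite LP => /and3P[].
(* If [m] is not adjacent to [a], local isometry at [l] gives a common neighbour [w] of [a] and [m].
   It is not [b], since every neighbour of [b] other than [a] is also a neighbour of [a]. *)
have NL l m : l \in L -> adj l m -> m != a -> m != b ->
    m \in L \/ exists w, [/\ w \in L, adj l w & adj m w].
  move=> lL lm ma mb; have [am|am] := boolP (adj a m).
    left; rewrite LP am mb; apply/negP=> mB.
    have := NB m l mB; rewrite adjC lm (negPf (LB l lL)) => /(_ isT).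
    by move: (lL) (lL); rewrite {1}LP LPb => /and3P[_ /negPf-> _] /and3P[_ /negPf-> _].
  right; have la : adj l a by rewrite adjC; move: lL; rewrite LP => /and3P[].
  have am' : a != m by rewrite eq_sym.
  have [w [lw aw mw]] := common_neighbour la lm am' am.
  exists w; split=> //; rewrite LP aw.
  have wB : w \notin B.
    apply/negP=> wB; have := NB w l wB; rewrite adjC lw (negPf (LB l lL)) => /(_ isT).
    by move: (lL) (lL); rewrite {1}LP LPb => /and3P[_ /negPf-> _] /and3P[_ /negPf-> _].
  rewrite wB andbT; apply: contraNneq am => wb; rewrite wb in mw.
  have : m \in nbhd b by rewrite inE adjC.
  rewrite Nb in_setU1 (negPf ma) in_setU /= => /orP[|mpq].
    by rewrite LP => /and3P[].
  by case: (inter a m aBpq mpq).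
have abl l : l \in L -> adj l a /\ adj l b.
  by rewrite !(adjC l) => lL; move: (lL) (lL);
    rewrite {1}LP LPb => /and3P[-> _ _] /and3P[-> _ _].
have cardL : #|L| <= 2.
  have dis : L :&: [set p; q] = set0.
    apply/eqP; rewrite -subset0; apply/subsetP=> r /setIP[/LB rB] rpq.
    by case: (inter a r aBpq rpq) => _; rewrite (negPf rB).
  have bN : b \notin L :|: [set p; q].
    rewrite in_setU LP eqxx andbF /=; apply/negP=> bpq.
    by case: (inter a b aBpq bpq) => _; rewrite (negPf bB).
  (* Three of the at most five neighbours of [a] are [b], [p] and [q]. *)
  by move: deg_a; rewrite /deg Na cardsU1 bN cardsU dis cards0 cards2 pq subn0
    addnCA (leq_add2r 3 _ 2).
(* An edge [lw] inside [L] exhausts [L]. Then [a] and [b] join [B] and become the new [p] and [q],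
   while [l] and [w] become the new [a] and [b]. *)
have [/existsP[l /andP[lL /existsP[w /andP[wL lw]]]]|noE] :=
    boolP [exists l in L, [exists w in L, adj l w]].
  have lNw := adj_neq lw.
  have LE : L = [set l; w].
    by apply/esym/eqP; rewrite eqEcard cards2 lNw cardL subUset !sub1set lL wL.
  pose B' := [set a; b] :|: B.
  have B'P u : (u \in B') = [|| u == a, u == b | u \in B] by rewrite !inE orbA.
  have lB' u : u \in L -> u \notin B'.
    move=> uL; rewrite B'P (negPf (LB u uL)) orbF; move: (uL) (uL).
    by rewrite {1}LP LPb => /and3P[_ /negPf-> _] /and3P[_ /negPf-> _].
  have NB' u : u \in L -> nbhd u :&: B' = [set a; b].
    move=> uL; apply/setP=> r; rewrite in_setI B'P inE !inE.
    case: eqVneq => [->|ra] /=; first by have [->] := abl u uL.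
    case: eqVneq => [->|rb] /=; first by have [_ ->] := abl u uL.
    apply/negP=> /andP[ur rB]; have := NB r u rB; rewrite adjC ur => /(_ isT).
    by apply/negP; rewrite -B'P lB'.
  apply: (IHn B' l w a b) => //; rewrite ?lB' ?NB' //.
  - apply: leq_trans leBn; apply/proper_card/properP; split.
      by rewrite setCS subsetUr.
    by exists a; rewrite !inE ?eqxx // aB.
  - by move=> u; rewrite B'P => /or3P[/eqP->|/eqP->|/degB].
  move=> u v; rewrite !B'P => /or3P[/eqP->|/eqP->|uB] uv.
  - have : v \in nbhd a by rewrite inE.
    rewrite Na LE !inE => /or3P[->|/orP[]->|]; rewrite ?orbT //.
    by rewrite -in_set2 => /(inter a v aBpq)[_ ->]; rewrite !orbT.
  - have : v \in nbhd b by rewrite inE.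
    rewrite Nb LE !inE => /or3P[->|/orP[]->|]; rewrite ?orbT //.
    by rewrite -in_set2 => /(inter a v aBpq)[_ ->]; rewrite !orbT.
  by case/or3P: (NB u v uB uv) => ->; rewrite !orbT.
(* Without an edge in [L], both outcomes of [NL] are impossible, so [a], [b], [L] and [B] together
   are closed under adjacency and make up the graph. *)
have NL2 l m : l \in L -> adj l m -> (m == a) || (m == b).
  move=> lL lm; have [//|ma] := eqVneq m a; have [//|mb] := eqVneq m b.
  case/existsP: noE; exists l; rewrite lL /=; apply/existsP.
  by case: (NL l m lL lm ma mb) => [mL|[w [wL lw _]]]; [exists m|exists w]; rewrite ?mL ?wL.
pose B' := [set a; b] :|: (L :|: B).
have full : forall x, x \in B'.
  apply: (closed_set_full (x := a)) => [|u v]; first by rewrite !inE eqxx.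
  rewrite in_setU in_set2 in_setU => /or3P[/orP[]/eqP-> uv|uL uv|uB uv].
  - have : v \in nbhd a by rewrite inE.
    rewrite Na in_setU1 in_setU => /or3P[/eqP->|vL|/(inter a v aBpq)[_ vB]].
    + by rewrite !inE eqxx ?orbT.
    + by rewrite !in_setU vL !orbT.
    by rewrite !in_setU vB !orbT.
  - have : v \in nbhd b by rewrite inE.
    rewrite Nb in_setU1 in_setU => /or3P[/eqP->|vL|/(inter a v aBpq)[_ vB]].
    + by rewrite !inE eqxx ?orbT.
    + by rewrite !in_setU vL !orbT.
    by rewrite !in_setU vB !orbT.
  - by rewrite in_setU in_set2 (NL2 u v uL uv).
  by rewrite in_setU in_set2 in_setU; case/or3P: (NB u v uB uv) => ->; rewrite ?orbT.
move=> x; have := full x; rewrite in_setU in_set2 in_setU.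
case/or3P=> [/orP[]/eqP-> //|xL|/degB //].
have : nbhd x \subset [set a; b].
  by apply/subsetP=> m; rewrite inE in_set2 => /(NL2 x m xL).
by move/subset_leq_card=> le; apply: leq_trans le _; rewrite cards2; case: (a != b).
Qed.
End LocalStructure.

(** * Configurations *)

(* Vertices of the graph are named by the numbers below [nv]. A fact [(i, j, b)]
   says whether [i] and [j] are adjacent. [cyc] lists, in cyclic order, the
   vertices whose position on C is known; the flag says whether unnamed vertices
   of C may follow before the next entry (a gap) or not (then the two entries
   are consecutive on C). [off] lists vertices outside C, [flo] those on C in an
   unknown gap, and [full] those all of whose neighbours are named. Delaying the
   choice of the gap of a new vertex of C keeps the case distinction small. *)
Record config := Config {
  nv : nat;
  facts : seq (nat * nat * bool);
  cyc : seq (nat * bool);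
  off : seq nat;
  flo : seq nat;
  full : seq nat }.

Definition known s b i j := ((i, j, b) \in facts s) || ((j, i, b) \in facts s).
Definition nbrs s i := [seq j <- iota 0 (nv s) | known s true i j].
(** As degrees are at most 6, six named neighbours are all the neighbours. This is why [nonadj] may
    read a missing adjacency at such a vertex as a nonadjacency. *)
Definition saturated s i := 6 <= size (nbrs s i).
Definition settled s i := (i \in full s) || saturated s i.
Definition nonadj s i j :=
  known s false i j || ~~ known s true i j && (saturated s i || saturated s j).
Definition located s := [seq e.1 | e <- cyc s].
Definition nxt s i := next (located s) i.
(* Makes [nv s] a fresh name. *)
Definition scoped s :=
  [&& all (fun f => (f.1.1 < nv s) && (f.1.2 < nv s)) (facts s),
      all (gtn (nv s)) (located s), all (gtn (nv s)) (off s),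
      all (gtn (nv s)) (flo s) & all (gtn (nv s)) (full s)].
Definition placed s :=
  all (fun i => [|| i \in off s, i \in flo s | i \in located s]) (iota 0 (nv s)).

Definition learn s L j b :=
  Config (nv s) ([seq (i, j, b) | i <- L] ++ facts s) (cyc s) (off s) (flo s) (full s).
Definition close_nbhd s i :=
  Config (nv s) (facts s) (cyc s) (off s) (flo s) (i :: full s).
(** A settled vertex has no unnamed neighbour, so outside [L] it is not adjacent to the new
    vertex. *)
Definition add_vertex s on L :=
  let n := nv s in
  Config n.+1
    ([seq (i, n, true) | i <- L] ++
     [seq (i, n, false) | i <- iota 0 n & settled s i && (i \notin L)] ++ facts s)
    (cyc s) (if on then off s else n :: off s) (if on then n :: flo s else flo s)
    (full s).
Definition close_gap s p :=
  Config (nv s) ((p, nxt s p, true) :: facts s)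
    [seq if e.1 == p then (p, false) else e | e <- cyc s] (off s) (flo s) (full s).
(** The flags [g1] and [g2] tell whether a gap may remain before and after [w]; where none remains,
    an edge of the cycle is recorded. *)
Definition insert s p w g1 g2 :=
  Config (nv s)
    ((if g1 then [::] else [:: (p, w, true)]) ++
     (if g2 then [::] else [:: (w, nxt s p, true)]) ++ facts s)
    (flatten [seq if e.1 == p then [:: (p, g1); (w, g2)] else [:: e] | e <- cyc s])
    (off s) [seq i <- flo s | i != w] (full s).

(* An extension of C is given by its list of named vertices, gaps being
   traversed whenever two successive ones bound a gap. In its trace, [(i, None)] is the
   vertex [i] and [(i, Some r)] the gap that follows [i] on C, traversed backwards
   when [r] holds. *)
Definition gap_link s a b :=
  if ((a, true) \in cyc s) && (nxt s a == b) then [:: (a, Some false)]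
  else if ((b, true) \in cyc s) && (nxt s b == a) then [:: (b, Some true)]
  else [::].
Definition linked s a b := (gap_link s a b != [::]) || known s true a b.
Fixpoint trace s a h :=
  if h is b :: h' then gap_link s a b ++ (b, None) :: trace s b h' else [::].
Definition forget (e : nat * option bool) := (e.1, isSome e.2).
Definition cyc_items s :=
  flatten [seq if e.2 then [:: (e.1, false); (e.1, true)] else [:: (e.1, false)]
          | e <- cyc s].
(** The permutation makes the closed walk meet its start off C, every named vertex of the cycle and
    every gap exactly once. A gap is used as a whole, so its unnamed vertices are covered too. *)
Definition extends s h :=
  if h is x :: h' then
    [&& x \in off s, path (linked s) x (rcons h' x) &
        perm_eq [seq forget e | e <- trace s x (rcons h' x)]
                ((x, false) :: cyc_items s)]
  else false.

Definition deg6_twins s a b :=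
  [&& known s true a b, saturated s a &
      all (fun j => (j == b) || known s true b j) (nbrs s a)].
(** A checkable form of the hypotheses of [strip_deg]. All neighbours of a member of [B] are named,
    so its degree is at most the number of other named vertices not excluded as neighbours. *)
Definition strip s a b p q B :=
  [&& known s true a b, p != q, p \in B, q \in B,
      all (fun u => [&& u < nv s, u \in full s, u != a & u != b]) B,
      (a < nv s) && (b < nv s),
      all (fun u => if u \in [:: p; q] then known s true a u && known s true b u
                    else nonadj s a u && nonadj s b u) B,
      all (fun u => all (fun j => (j \in [:: a, b & B]) || nonadj s u j) (iota 0 (nv s))) B
    & all (fun u => count (fun j => (j != u) && ~~ nonadj s u j) (iota 0 (nv s)) <= 5) B].

Definition K24_K1 := join (complete_bipartite 2 4) (complete 1).
(* The vertices of [K24_K1] are listed as the two sides of [K_{2,4}], then the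
   apex. *)
Definition position (x : K24_K1) : nat :=
  match x with
  | inl (inl i) => i
  | inl (inr i) => i.+2
  | inr _ => 6
  end.
(** Meant for distinct positions: the apex 6 would otherwise be adjacent to itself. *)
Definition position_adj i j := [|| i == 6, j == 6 | (i < 2) != (j < 2)].
(** The list [l] gives the names in the order of [position]. As all of them are settled,
    connectivity leaves no further vertex. *)
Definition target s l :=
  [&& perm_eq l (iota 0 7), nv s == 7, all (settled s) l &
      all (fun i => all (fun j => (i == j) ||
        if position_adj i j then known s true (nth 0 l i) (nth 0 l j)
        else nonadj s (nth 0 l i) (nth 0 l j)) (iota 0 7)) (iota 0 7)].

(* [Meet v a b f t1 t2]: the nonadjacent neighbours [a] and [b] of [v] have a
   common neighbour adjacent to [v]; it is a named vertex [j] (case [f j]) or a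
   new one, off C ([t1]) or on C ([t2]).
   [Step d p t1 f t2]: in the gap after [p], the vertex next to the first end
   (the last end if [d] is false) is the other end ([t1]), a floating vertex [j]
   ([f j]) or a new vertex ([t2]).
   [Loc w f]: the floating vertex [w] lies in the gap after some [p] ([f p]).
   [Full v t1 t2 t3]: [v] has an unnamed neighbour off C ([t1]) or on C ([t2]),
   or none ([t3]). *)
Inductive tree :=
  | Ham of seq nat
  | Twins of nat & nat
  | Strip of nat & nat & nat & nat & seq nat
  | Iso of seq nat
  | Case of nat & nat & tree & tree
  | Meet of nat & nat & nat & (nat -> tree) & tree & tree
  | Step of bool & nat & tree & (nat -> tree) & tree
  | Loc of nat & (nat -> tree)
  | Full of nat & tree & tree & tree.

(** Always rejected by the checker, hence only usable in branches that the known facts already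
    exclude. *)
Definition dead := Ham [::].
Definition none (i : nat) := dead.
Definition alt i t f : nat -> tree := fun j => if j == i then t else f j.

(** A leaf contradicting local isometry: it is accepted only if no vertex, named or new, can be the
    required common neighbour. *)
Definition Apart v a b := Meet v a b none dead dead.

(** The disjunctions skip the subtrees of branches excluded by the known facts. In [Step], the test
    [placed] ensures that a named vertex inside a gap is floating, and the flags [(~~ d)] and [d]
    close the side of the gap towards the end [r]. *)
Fixpoint refutes t s :=
  match t with
  | Ham h => extends s h
  | Twins a b => deg6_twins s a b
  | Strip a b p q B => strip s a b p q B
  | Iso l => target s l
  | Case a b t1 t2 =>
      [&& a < nv s, b < nv s,
          nonadj s a b || refutes t1 (learn s [:: a] b true) &
          known s true a b || refutes t2 (learn s [:: a] b false)]
  | Meet v a b f t1 t2 =>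
      let L := [:: v; a; b] in
      [&& a != b, known s true v a, known s true v b, nonadj s a b,
          [&& v < nv s, a < nv s & b < nv s],
          all (fun j => [|| j \in L, has (nonadj s j) L
                          | refutes (f j) (learn s L j true)]) (iota 0 (nv s)) &
          has (settled s) L ||
          [&& scoped s, refutes t1 (add_vertex s false L)
                      & refutes t2 (add_vertex s true L)]]
  | Step d p t1 f t2 =>
      let r := if d then p else nxt s p in
      [&& (p, true) \in cyc s, scoped s, placed s,
          nonadj s p (nxt s p) || refutes t1 (close_gap s p),
          all (fun w => nonadj s r w || refutes (f w) (insert s p w (~~ d) d)) (flo s) &
          settled s r || refutes t2 (insert (add_vertex s true [::]) p (nv s) (~~ d) d)]
  | Loc w f =>
      [&& w \in flo s, w \notin located s, scoped s &
          all (fun e => e.2 ==> refutes (f e.1) (insert s e.1 w true true)) (cyc s)]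
  | Full v t1 t2 t3 =>
      [&& scoped s, v < nv s, refutes t1 (add_vertex s false [:: v]),
          refutes t2 (add_vertex s true [:: v]) & refutes t3 (close_nbhd s v)]
  end.

Definition start :=
  Config 4 [:: (0, 1, true); (0, 2, true); (0, 3, true)]
    [:: (0, false); (2, true); (1, false)] [:: 3] [::] [::].

(** * Soundness of the checker *)

Section Soundness.
Variable G : sgraph.
Hypothesis Gconn : connected G.
Hypothesis Gloc : locally_isometric G.
Hypothesis Gmax : max_deg G = 6.
Hypothesis Gtwins :
  ~ exists u v : G, [/\ true_twins u v, deg u = 6 & deg v = 6].
Variable c : seq G.
Hypothesis c_cycle : is_cycle c.

Definition flat (rho : nat -> G) (P : nat -> seq G) (l : seq (nat * bool)) :=
  flatten [seq rho e.1 :: P e.1 | e <- l].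
Definition named (rho : nat -> G) s := [seq rho i | i <- iota 0 (nv s)].

Definition visit (rho : nat -> G) (P : nat -> seq G) (e : nat * option bool) :=
  if e.2 is Some r then if r then rev (P e.1) else P e.1 else [:: rho e.1].

(* [rho] interprets the names and [P i] is the gap after [i]. Only the vertex set
   of the cycle matters for extendability, so the listed cycle need not be [c]
   itself. *)
Record valid rho P s : Prop := Valid {
  vinj : {in gtn (nv s) &, injective rho};
  vfacts : forall i j b, (i, j, b) \in facts s -> adj (rho i) (rho j) = b;
  vcyc : cycle (@adj G) (flat rho P (cyc s));
  vperm : perm_eq (flat rho P (cyc s)) c;
  vgap : forall i, (i, false) \in cyc s -> P i = [::];
  voff : forall i, i \in off s -> rho i \notin c;
  vflo : forall i, i \in flo s -> rho i \in c;
  vfull : forall i, i \in full s -> forall u, adj (rho i) u -> u \in named rho s }.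

Section Valid.
Variables (rho : nat -> G) (P : nat -> seq G) (s : config).
Hypothesis V : valid rho P s.

Lemma knownP b i j : known s b i j -> adj (rho i) (rho j) = b.
Proof. by case/orP=> /(vfacts V) //; rewrite adjC. Qed.

Lemma namedP u : reflect (exists2 i, i < nv s & u = rho i) (u \in named rho s).
Proof.
apply: (iffP mapP) => -[i]; first by rewrite mem_iota /= add0n => lt ->; exists i.
by move=> lt ->; exists i; rewrite ?mem_iota.
Qed.

Lemma uniq_nbrs i : uniq [seq rho j | j <- nbrs s i].
Proof.
rewrite map_inj_in_uniq ?filter_uniq ?iota_uniq // => j k.
by rewrite !mem_filter !mem_iota /= !add0n => /andP[_ j_lt] /andP[_ k_lt]; apply: (vinj V).
Qed.

Lemma nbrs_nbhd i : {subset [seq rho j | j <- nbrs s i] <= nbhd (rho i)}.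
Proof. by move=> _ /mapP[j + ->]; rewrite mem_filter inE => /andP[/knownP ->]. Qed.

Lemma size_nbrs i : size (nbrs s i) <= deg (rho i).
Proof.
rewrite -(size_map rho) -(card_uniqP (uniq_nbrs i)).
by apply/subset_leq_card/subsetP/nbrs_nbhd.
Qed.

Lemma deg_le6 (v : G) : deg v <= 6.
Proof. by rewrite -Gmax deg_le_max. Qed.

Lemma saturated_deg i : saturated s i -> deg (rho i) = 6.
Proof.
by move=> sat; apply/eqP; rewrite eqn_leq deg_le6 (leq_trans sat (size_nbrs i)).
Qed.

Lemma saturatedP i u : saturated s i -> adj (rho i) u ->
  u \in [seq rho j | j <- nbrs s i].
Proof.
move=> sat iu; have cardE : #|[seq rho j | j <- nbrs s i]| = #|nbhd (rho i)|.
  rewrite (card_uniqP (uniq_nbrs i)) size_map -/(deg _) saturated_deg //.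
  by apply/eqP; rewrite eqn_leq (leq_trans (size_nbrs i)) ?deg_le6.
have /(subset_cardP cardE)-> : [seq rho j | j <- nbrs s i] \subset nbhd (rho i).
  exact/subsetP/nbrs_nbhd.
by rewrite inE.
Qed.

Lemma nonadjP i j : nonadj s i j -> i < nv s -> j < nv s -> ~~ adj (rho i) (rho j).
Proof.
have satP k l : saturated s k -> ~~ known s true k l -> l < nv s -> ~~ adj (rho k) (rho l).
  move=> sat kn l_lt; apply: contra kn => /(saturatedP sat)/mapP[m].
  rewrite mem_filter mem_iota /= add0n => /andP[km m_lt] /(vinj V) -> //.
case/orP=> [/knownP-> //|/andP[kn /orP[sat|sat]] i_lt j_lt]; first exact: satP.
by rewrite adjC; apply: satP => //; rewrite /known orbC.
Qed.

Lemma settledP i u : settled s i -> adj (rho i) u -> u \in named rho s.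
Proof.
case/orP=> [/(vfull V) sat|sat] iu; first exact: sat.
have /mapP[j] := saturatedP sat iu; rewrite mem_filter => /andP[_ j_lt] ->.
exact: map_f.
Qed.


(** * Updates of a configuration *)

Lemma valid_learn (L : seq nat) j b :
  {in L, forall i, adj (rho i) (rho j) = b} -> valid rho P (learn s L j b).
Proof.
move=> LP; case: V => *; split=> //= i k b'.
by rewrite mem_cat => /orP[/mapP[l lL [-> -> ->]]|]; [apply: LP|auto].
Qed.

Lemma valid_close_nbhd i :
  (forall u, adj (rho i) u -> u \in named rho s) -> valid rho P (close_nbhd s i).
Proof. by move=> iP; case: V => *; split=> //= k; rewrite inE => /predU1P[->|/(vfull V)]. Qed.

Lemma flat_eq (rho' : nat -> G) (P' : nat -> seq G) l :
    {in [seq e.1 | e <- l], rho =1 rho'} -> {in [seq e.1 | e <- l], P =1 P'} ->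
  flat rho P l = flat rho' P' l.
Proof.
move=> rhoE PE; congr flatten; apply/eq_in_map=> e el.
by rewrite rhoE ?PE //; apply: map_f.
Qed.

(** By [scoped], nothing recorded in [s] mentions the name [nv s], so giving it the value [u]
    preserves the earlier data. *)
Lemma valid_add_vertex on (L : seq nat) u :
    scoped s -> u \notin named rho s -> (u \in c) = on ->
    {in L, forall i, (i < nv s) && adj (rho i) u} ->
  valid (fun i => if i == nv s then u else rho i) P (add_vertex s on L).
Proof.
case/and5P=> /allP facts_lt /allP cyc_lt /allP off_lt /allP flo_lt /allP full_lt.
move=> u_new u_on LP.
pose rho' i := if i == nv s then u else rho i; rewrite -/rho'.
have old i : i < nv s -> rho' i = rho i by rewrite /rho'; case: eqVneq => // ->; rewrite ltnn.
have new : rho' (nv s) = u by rewrite /rho' eqxx.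
have uP i : i < nv s -> rho i <> u.
  by move=> lt iu; case/negP: u_new; rewrite -iu map_f // mem_iota.
have flatE : flat rho' P (cyc s) = flat rho P (cyc s).
  by apply/esym/flat_eq => // i /cyc_lt i_lt; rewrite old.
split=> /=; rewrite ?flatE; try by case: V.
- move=> i j; rewrite !inE !ltnS (leq_eqVlt i) (leq_eqVlt j).
  case/predU1P=> [->|i_lt] /predU1P[->|j_lt] //; rewrite ?new ?old //.
  + by move=> eu; case: (uP j).
  + by move=> eu; case: (uP i).
  exact: (vinj V).
- move=> i j b; rewrite !mem_cat => /or3P[/mapP[l lL [-> -> ->]]|/mapP[l + [-> -> ->]]|ijb].
  + by case/andP: (LP l lL) => lt lu; rewrite new old.
  + rewrite mem_filter mem_iota add0n => /andP[/andP[lc lL] /= lt].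
    by rewrite new old //; apply: contraNF u_new; apply: settledP.
  by have /andP[/= i_lt j_lt] := facts_lt _ ijb; rewrite !old // (vfacts V ijb).
- move=> i; case: on u_on => u_on; last rewrite inE => /predU1P[->|].
  + by move=> io; rewrite old ?(voff V) //; apply: off_lt.
  + by rewrite new u_on.
  by move=> io; rewrite old ?(voff V) //; apply: off_lt.
- move=> i; case: on u_on => u_on; first rewrite inE => /predU1P[->|].
  + by rewrite new u_on.
  + by move=> io; rewrite old ?(vflo V) //; apply: flo_lt.
  by move=> io; rewrite old ?(vflo V) //; apply: flo_lt.
move=> i ifull v; rewrite old; last exact: full_lt.
move=> /(vfull V ifull)/namedP[j j_lt ->].
by apply/mapP; exists j; rewrite ?old // mem_iota leqW.
Qed.

Lemma uniq_located : uniq (located s).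
Proof.
have : uniq (flat rho P (cyc s)) by rewrite (perm_uniq (vperm V)); case: c_cycle => /andP[].
rewrite /located; elim: (cyc s) => //= e l IHl /andP[].
rewrite mem_cat negb_or => /andP[_ el]; rewrite cat_uniq => /and3P[_ _ /IHl->].
rewrite andbT; apply: contra el => /mapP[f fl ->].
by apply/flattenP; exists (rho f.1 :: P f.1); rewrite ?mem_head //; apply/mapP; exists f.
Qed.

(** After rotating the cycle to start at [p], its gap is followed by the next located vertex, which
    is [p] itself if no other is located. *)
Lemma gap_path p : p \in located s ->
  path (@adj G) (rho p) (rcons (P p) (rho (nxt s p))).
Proof.
case/mapP=> -[q g] /splitPr pl -> /=; rewrite /nxt.
have := vcyc V; have := uniq_located; rewrite /located.
case: (cyc s) / pl => l1 l2 Ul.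
rewrite -(next_rot (size [seq e.1 | e <- l1]) Ul) /flat !map_cat flatten_cat.
rewrite -(rot_cycle (size (flat rho P l1))) !rot_size_cat /=.
rewrite -map_cat -catA -flatten_cat -map_cat.
case: (l2 ++ l1) => [|[r h] l3] /=; rewrite eqxx; first by rewrite cats0.
by rewrite (rcons_path _ _ (P q)) rcons_cat cat_path /= => /and3P[-> ->].
Qed.

Lemma valid_close_gap p : p \in located s -> P p = [::] -> valid rho P (close_gap s p).
Proof.
move=> p_loc Pp; have := gap_path p_loc; rewrite Pp /= andbT => adj_p.
have flatE : flat rho P (cyc (close_gap s p)) = flat rho P (cyc s).
  by rewrite /flat /= -map_comp; congr flatten; apply: eq_map => e /=; case: eqP => [->|].
split; rewrite ?flatE; try by case: V.
- by move=> i j b; rewrite inE => /predU1P[[-> -> ->]|/(vfacts V)].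
by move=> i /mapP[[j g] jg /=]; case: eqP => [_ [->] //|_ [-> gF]]; apply: (vgap V); rewrite gF.
Qed.

(** Cutting a gap at [w] leaves the flattened cycle unchanged; the new adjacencies come from
    [gap_path]. *)
Lemma valid_insert p w r1 r2 g1 g2 :
    (p, true) \in cyc s -> P p = r1 ++ rho w :: r2 -> w \notin located s ->
    (~~ g1 -> r1 = [::]) -> (~~ g2 -> r2 = [::]) ->
  valid rho (fun i => if i == w then r2 else if i == p then r1 else P i)
    (insert s p w g1 g2).
Proof.
move=> p_cyc Pp w_loc g1P g2P; set P' := fun i => _.
have p_loc : p \in located s by apply: (map_f fst p_cyc).
have pw : p != w by apply: contraNneq w_loc => <-.
have P'p : P' p = r1 by rewrite /P' (negPf pw) eqxx.
have P'w : P' w = r2 by rewrite /P' eqxx.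
have P'old i : i \in located s -> i != p -> P' i = P i.
  move=> i_loc /negPf ip; rewrite /P' ip; case: eqP => // iw.
  by rewrite -iw i_loc in w_loc.
have flatE : flat rho P' (cyc (insert s p w g1 g2)) = flat rho P (cyc s).
  rewrite /flat /=; have : {subset [seq e.1 | e <- cyc s] <= located s} by [].
  elim: (cyc s) => //= -[q g] l IHl l_loc; rewrite map_cat flatten_cat IHl; last first.
    by move=> i il; apply: l_loc; rewrite inE il orbT.
  rewrite -cat_cons; congr (_ ++ _); case: eqVneq => [->|qp] /=; first
    by rewrite P'p P'w cats0 Pp.
  by rewrite cats0 P'old // l_loc ?mem_head.
have := gap_path p_loc; rewrite Pp rcons_cat cat_path rcons_cons /= => /and3P[p1 p2 p3].
split; rewrite ?flatE; try by case: V.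
- move=> i j b; rewrite !mem_cat => /or3P[||/(vfacts V) //].
  + by case: ifP => // /negbT/g1P r1E; rewrite inE => /eqP[-> -> ->]; rewrite r1E in p2.
  by case: ifP => // /negbT/g2P r2E; rewrite inE => /eqP[-> -> ->]; rewrite r2E /= andbT in p3.
- move=> i /flattenP[_ /mapP[[q g] qg ->]] /=; case: eqVneq => [_|qp].
  + by rewrite !inE => /orP[/eqP[-> g1F]|/eqP[-> g2F]];
       rewrite ?P'p ?P'w ?g1P ?g2P -?g1F -?g2F.
  rewrite inE => /eqP[-> gF]; rewrite P'old ?(vgap V) ?gF //.
  by apply: (map_f fst qg).
by move=> i; rewrite mem_filter => /andP[_ /(vflo V)].
Qed.

Lemma mem_flat u : u \in flat rho P (cyc s) ->
  exists2 e, e \in cyc s & u = rho e.1 \/ u \in P e.1.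
Proof.
case/flattenP=> _ /mapP[e e_cyc ->]; rewrite inE => /predU1P ue.
by exists e.
Qed.

Lemma mem_cyc u : u \in c -> exists2 e, e \in cyc s & u = rho e.1 \/ u \in P e.1.
Proof. by rewrite -(perm_mem (vperm V)); apply: mem_flat. Qed.

Lemma gap_mem p u : p \in located s -> u \in P p -> u \in c.
Proof.
case/mapP=> e e_cyc -> ue; rewrite -(perm_mem (vperm V)).
by apply/flattenP; exists (rho e.1 :: P e.1); rewrite ?inE ?ue ?orbT //; apply/mapP; exists e.
Qed.

Lemma gap_notin_located p i :
  p \in located s -> rho i \in P p -> i \notin located s.
Proof.
have : uniq (flat rho P (cyc s)) by rewrite (perm_uniq (vperm V)); case: c_cycle => /andP[].
have sub j u (l : seq (nat * bool)) : j \in [seq e.1 | e <- l] ->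
    u \in rho j :: P j -> u \in flat rho P l.
  by case/mapP=> e el -> ue; apply/flattenP; exists (rho e.1 :: P e.1); rewrite ?map_f //;
     apply/mapP; exists e.
rewrite /located; elim: (cyc s) => //= e l IHl /andP[+ Ul].
move: Ul; rewrite cat_uniq mem_cat negb_or => /and3P[_ /hasPn disj Ul] /andP[eP el] + iP.
rewrite !inE => /predU1P[pE|pl]; apply/norP; split.
- by apply: contraNneq eP => ie; rewrite -ie {2}ie -pE.
- apply/negP=> il; have /negP[] := disj _ (sub _ _ _ il (mem_head _ _)).
  by rewrite -pE.
- by apply: contraNneq el => <-; apply: sub pl _; rewrite inE iP orbT.
by apply: IHl.
Qed.

(** * Leaves of the case tree *)

Lemma trace_path h a : path (linked s) a h ->
  path (@adj G) (rho a) (flatten [seq visit rho P e | e <- trace s a h]).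
Proof.
elim: h a => //= b h IHh a /andP[ab /IHh bh].
have : path (@adj G) (rho a) (flatten [seq visit rho P e | e <- gap_link s a b] ++ [:: rho b]).
  move: ab; rewrite /linked /gap_link.
  case: andP => [[a_cyc /eqP <-] _|_].
    by rewrite /= cats0 cats1; apply/gap_path/(map_f fst a_cyc).
  case: andP => [[b_cyc /eqP <-] _|_ /= /knownP->] //.
  rewrite /= cats0 cats1.
  (* Here the gap after [b] is traversed backwards, from its last end [a] to [b]. *)
  have := rev_path (@adj G) (rho b) (rcons (P b) (rho (nxt s b))).
  rewrite last_rcons belast_rcons rev_cons => ->.
  rewrite (eq_path (e' := @adj G)) => [|x y]; last exact: adjC.
  exact/gap_path/(map_f fst b_cyc).
by rewrite map_cat flatten_cat !cat_path /= => /and3P[-> -> _].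
Qed.

(** Isolates the final return to [x], which is dropped when the closed walk is written as a
    cycle. *)
Lemma visit_trace_rcons h a x :
  exists m, flatten [seq visit rho P e | e <- trace s a (rcons h x)] = rcons m (rho x).
Proof.
elim: h a => [|b h IHh] a /=; rewrite map_cat flatten_cat /=.
  by eexists; rewrite cats1.
by have [m ->] := IHh b; eexists; rewrite -rcons_cons -rcons_cat.
Qed.

Lemma extends_sound h : extends s h -> extendable c.
Proof.
case: h => //= x h /and3P[x_off h_path h_perm].
have := trace_path h_path; have [m mE] := visit_trace_rcons h x x.
have D_perm : perm_eq (rho x :: m) (rho x :: c).
  rewrite -perm_rcons -mE.
  (* The direction in which a gap is traversed does not affect its vertices up to permutation, so
     the walk can be compared with the cycle through [forget]. *)
  pose visit' (e : nat * bool) := if e.2 then P e.1 else [:: rho e.1].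
  have cycE : flatten [seq visit' e | e <- cyc_items s] = flat rho P (cyc s).
    rewrite /flat /cyc_items; have := vgap V; elim: (cyc s) => //= -[i g] l IHl gapP.
    rewrite map_cat flatten_cat {}IHl => [|j jl]; last by apply: gapP; rewrite inE jl orbT.
    by case: g gapP => /= gapP; rewrite /visit' /= ?cats0 // (gapP i) ?mem_head.
  apply: (@perm_trans _ (flatten [seq visit' (forget e) | e <- trace s x (rcons h x)])).
    elim: (trace _ _ _) => //= e l IHl; apply: perm_cat => //.
    by case: e => i [[]|] //=; rewrite perm_rev.
  rewrite map_comp; apply: perm_trans (perm_flatten (perm_map _ h_perm)) _.
  by rewrite /= cycE perm_cons (vperm V).
rewrite mE => m_path; case: c_cycle => /andP[_ c_uniq] c_size.
exists (rho x), (rho x :: m); split; first exact: (voff V).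
  split; last by rewrite (perm_size D_perm) /= leqW.
  by rewrite /ucycle [cycle _ _]m_path (perm_uniq D_perm) /= (voff V).
by apply/setP=> u; have := perm_mem D_perm u; rewrite !inE.
Qed.

(** Inclusion of the closed neighbourhoods is enough, since that of [a] already has the largest
    possible size 7. *)
Lemma deg6_twins_sound a b : ~~ deg6_twins s a b.
Proof.
apply/negP=> /and3P[ab sat_a /allP abN]; apply: Gtwins.
have adj_ab := knownP ab.
have sub : cnbhd (rho a) \subset cnbhd (rho b).
  apply/subsetP=> u; rewrite !inE => /predU1P[->|au]; first by rewrite adjC adj_ab orbT.
  have /mapP[j jN ->] := saturatedP sat_a au.
  by case/orP: (abN j jN) => [/eqP->|/knownP->]; rewrite ?eqxx ?orbT.
have cE : cnbhd (rho a) = cnbhd (rho b).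
  by apply/eqP; rewrite eqEcard sub !cnbhd_card (saturated_deg sat_a) ltnS deg_le6.
have dE : deg (rho a) = deg (rho b) by apply: succn_inj; rewrite -!cnbhd_card cE.
exists (rho a), (rho b); split; rewrite -?dE ?saturated_deg //.
by split=> // eab; rewrite eab adj_irrefl in adj_ab.
Qed.

Lemma strip_sound a b p q B : ~~ strip s a b p q B.
Proof.
apply/negP=> /and5P[ab pq pB qB].
case/and5P=> /allP B_full /andP[a_lt b_lt] /allP abB /allP B_nb /allP B_deg.
pose B' : {set G} := [set u in [seq rho i | i <- B]].
have B'P u : reflect (exists2 i, i \in B & u = rho i) (u \in B').
  by rewrite inE; apply: mapP.
have neqB d u : d < nv s -> u < nv s -> u != d -> rho u != rho d.
  by move=> d_lt u_lt; apply: contra_neq; apply: (vinj V).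
have deg5 : forall x : G, deg x <= 5; last first.
  have : max_deg G <= 5 by apply/bigmax_leqP => u _; apply: deg5.
  by rewrite Gmax.
have deg_le v : deg v <= 6 := deg_le6 v.
have end_nbhd d : d < nv s ->
    (forall u, u \in B ->
       if u \in [:: p; q] then known s true d u else nonadj s d u) ->
    nbhd (rho d) :&: B' = [set rho p; rho q].
  move=> d_lt dB; apply/setP=> u; rewrite in_setI in_set2 [_ \in nbhd _]inE.
  apply/andP/orP=> [[du /B'P[i iB ue]]|].
    have := dB i iB; rewrite !inE; case: ifP => [/orP[]/eqP<- _|_ /nonadjP].
    - by left; rewrite ue.
    - by right; rewrite ue.
    by have /and4P[i_lt _ _ _] := B_full i iB => /(_ d_lt i_lt)/negP[]; rewrite -ue.
  have dp : known s true d p by have := dB p pB; rewrite !inE eqxx.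
  have dq : known s true d q by have := dB q qB; rewrite !inE eqxx orbT.
  case=> /eqP->; split; rewrite ?(knownP dp) ?(knownP dq) //; apply/B'P.
    by exists p.
  by exists q.
apply: (@strip_deg G Gconn Gloc deg_le Gtwins B' (rho a) (rho b) (rho p) (rho q)).
- exact: knownP ab.
- apply/B'P=> -[i iB /eqP]; have /and4P[i_lt _ ia ib] := B_full i iB.
  by rewrite eq_sym (negPf (neqB a i _ _ _)).
- apply/B'P=> -[i iB /eqP]; have /and4P[i_lt _ ia ib] := B_full i iB.
  by rewrite eq_sym (negPf (neqB b i _ _ _)).
- by apply: neqB; have /and4P[] := B_full _ pB; have /and4P[] := B_full _ qB.
- by apply: end_nbhd => // u /abB; case: ifP => _ /andP[].
- by apply: end_nbhd => // u /abB; case: ifP => _ /andP[].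
- move=> _ /B'P[i iB ->]; apply: leq_trans (B_deg i iB).
  have /and4P[i_lt i_full _ _] := B_full i iB.
  rewrite -size_filter -(size_map rho); set l := map _ _.
  apply: leq_trans (card_size l); apply/subset_leq_card/subsetP=> u; rewrite inE => iu.
  have /mapP[j j_iota ue] := vfull V i_full iu.
  rewrite ue /l map_f // mem_filter j_iota andbT.
  have j_lt : j < nv s by rewrite mem_iota in j_iota.
  rewrite ue in iu; apply/andP; split.
    by apply: contraTneq iu => ->; rewrite adj_irrefl.
  by apply/negP=> /nonadjP/(_ i_lt j_lt); rewrite iu.
move=> u v /B'P[i iB ->] iv; have /and4P[i_lt i_full _ _] := B_full i iB.
have /namedP[j j_lt ve] := vfull V i_full iv.
have := allP (B_nb i iB) j; rewrite mem_iota => /(_ j_lt)/orP[|/nonadjP].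
  rewrite !inE ve => /or3P[/eqP->|/eqP->|jB]; rewrite ?eqxx ?orbT //.
  by apply/or3P/Or33; rewrite map_f.
by move=> /(_ i_lt j_lt); rewrite -ve iv.
Qed.

Lemma target_sound l : target s l -> isomorphic G K24_K1.
Proof.
case/and4P=> l_perm /eqP nv7 /allP l_settled /allP l_adj.
have l_size : size l = 7 by rewrite (perm_size l_perm).
have pos_lt (x : K24_K1) : position x < 7.
  case: x => [[i|i]|i] //=; first exact: leq_trans (ltn_ord i) _.
  by rewrite !ltnS ltnW.
have pos_inj : injective position.
  case=> [[i|i]|i] [[j|j]|j] //=; rewrite ?(ord1 i) ?(ord1 j) //.
  - by move/val_inj->.
  - by move=> ij; have := ltn_ord i; rewrite ij.
  - by move=> ij; have := ltn_ord i; rewrite ij.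
  - by move=> ij; have := ltn_ord j; rewrite -ij.
  - by case=> /val_inj->.
  - by case=> ij; have := ltn_ord i; rewrite ij.
  - by move=> ij; have := ltn_ord j; rewrite -ij.
  by case=> ij; have := ltn_ord j; rewrite -ij.
have pos_adj (x y : K24_K1) : x != y -> adj x y = position_adj (position x) (position y).
  have lt2 (i : 'I_2) : ((i == 6 :> nat) = false) * ((i < 2) = true).
    by split; [apply: ltn_eqF; apply: leq_trans (ltn_ord i) _ | exact: ltn_ord].
  have lt4 (i : 'I_4) : ((i.+2 == 6) = false) * ((i.+2 < 2) = false).
    by split=> //; apply/ltn_eqF; have := ltn_ord i.
  by case: x y => [[i|i]|i] [[j|j]|j] //=; rewrite /position_adj ?eqxx ?lt2 ?lt4 ?orbT // !ord1.
have nth_lt i : i < 7 -> nth 0 l i < nv s.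
  move=> lt; have := mem_nth 0 (s := l) (n := i).
  by rewrite l_size (perm_mem l_perm) mem_iota nv7 => /(_ lt).
pose g (x : K24_K1) := rho (nth 0 l (position x)).
have g_inj : injective g.
  move=> x y /(vinj V) E; apply/pos_inj/eqP.
  rewrite -(nth_uniq 0 (s := l)) ?l_size ?pos_lt //; last by rewrite (perm_uniq l_perm) iota_uniq.
  by apply/eqP/E; apply: nth_lt.
have g_adj x y : adj (g x) (g y) = adj x y.
  have [->|xy] := eqVneq x y; first by rewrite !adj_irrefl.
  have pos_in z : position z \in iota 0 7 by rewrite mem_iota pos_lt.
  have /allP/(_ _ (pos_in y)) := l_adj _ (pos_in x).
  rewrite (pos_adj x y xy) (inj_eq pos_inj) (negPf xy) /=.
  case: ifP => _; first exact: knownP.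
  by move/nonadjP/(_ (nth_lt _ (pos_lt x)) (nth_lt _ (pos_lt y)))/negPf.
have g_img u : u \in named rho s -> exists x, g x = u.
  case/namedP=> i i_lt ->; have i_l : i \in l by rewrite (perm_mem l_perm) mem_iota -nv7.
  suff [x xE] : exists x : K24_K1, position x = index i l.
    by exists x; rewrite /g xE nth_index.
  have : index i l < 7 by rewrite -l_size index_mem.
  move: (index i l) => k k_lt; have [k2|k2] := ltnP k 2; first by exists (inl (inl (Ordinal k2))).
  have [k6|k6] := ltnP k 6.
    have k4 : k - 2 < 4 by rewrite ltn_subLR.
    by exists (inl (inr (Ordinal k4))); rewrite /= -[_.+2]/(2 + _) subnKC.
  by exists (inr ord0); apply/eqP; rewrite /= eqn_leq k6.
(* The named vertices are closed under adjacency because all are settled; this makes [g]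
   surjective. *)
have all_named : forall u, u \in [set u | u \in named rho s].
  apply: (@closed_set_full G Gconn _ (rho 0)) => [|u v].
    by rewrite inE map_f // nv7.
  rewrite !inE => /namedP[i i_lt ->]; apply: settledP; apply: l_settled.
  by rewrite (perm_mem l_perm) mem_iota -nv7.
have [f gK fK] : bijective g.
  apply: (inj_card_bij g_inj); rewrite -(card_codom g_inj).
  apply/subset_leq_card/subsetP=> u _.
  by have := all_named u; rewrite inE => /g_img[x <-]; apply: codom_f.
by exists f; split=> [|x y]; [exists g | rewrite -g_adj !fK].
Qed.

End Valid.

(** * Induction on the case tree *)

Lemma scoped_located s i : scoped s -> i \in located s -> i < nv s.
Proof. by case/and5P=> _ /allP/(_ i). Qed.

Theorem refutes_sound t rho P s :
  valid rho P s -> refutes t s -> extendable c \/ isomorphic G K24_K1.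
Proof.
elim: t rho P s => [h|a b|a b p q B|l|a b t1 IH1 t2 IH2|v a b f IHf t1 IH1 t2 IH2
  |d p t1 IH1 f IHf t2 IH2|w f IHf|v t1 IH1 t2 IH2 t3 IH3] rho P s V /=.
- by move/(extends_sound V); left.
- by rewrite (negPf (deg6_twins_sound V a b)).
- by rewrite (negPf (strip_sound V a b p q B)).
- by move/(target_sound V); right.
- case/and4P=> a_lt b_lt r1 r2; have [ab|/negPf ab] := boolP (adj (rho a) (rho b)).
    case/orP: r1 => [/(nonadjP V)/(_ a_lt b_lt)|]; first by rewrite ab.
    by apply: (IH1 _ _ _ (valid_learn V _)) => i; rewrite inE => /eqP->.
  case/orP: r2 => [/(knownP V)|]; first by rewrite ab.
  by apply: (IH2 _ _ _ (valid_learn V _)) => i; rewrite inE => /eqP->.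
- set L := [:: v; a; b].
  case/and5P=> ab va vb nab /and3P[/and3P[v_lt a_lt b_lt] named_ok new_ok].
  have rab : rho a != rho b by apply: contra_neq ab; apply: (vinj V).
  have [w [vw aw bw]] :=
    common_neighbour Gloc (knownP V va) (knownP V vb) rab (nonadjP V nab a_lt b_lt).
  have Lw : {in L, forall i, (i < nv s) && adj (rho i) w}.
    by move=> i; rewrite !inE => /or3P[]/eqP->; apply/andP.
  have [/namedP[j j_lt wE]|w_new] := boolP (w \in named rho s).
    have := allP named_ok j; rewrite mem_iota => /(_ j_lt)/or3P[jL|nij|].
    - by have /andP[_] := Lw j jL; rewrite wE adj_irrefl.
    - have /hasP[i iL {}nij] : has (nonadj s j) L := nij.
      have /andP[i_lt] := Lw i iL; rewrite wE adjC => ij.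
      by have := nonadjP V nij j_lt i_lt; rewrite ij.
    apply: (IHf _ _ _ _ (valid_learn V _)) => i /Lw/andP[_].
    by rewrite wE.
  case/orP: new_ok => [L_settled|/and3P[s_scoped r1 r2]].
    have /hasP[i iL i_settled] : has (settled s) L := L_settled.
    by have /andP[_ /(settledP V i_settled)] := Lw i iL; rewrite (negPf w_new).
  have V' := valid_add_vertex V s_scoped w_new (erefl _) Lw.
  by case: (w \in c) V' => V'; [apply: IH2 V' r2 | apply: IH1 V' r1].
- set r := if d then p else nxt s p.
  case/and5P=> p_cyc s_scoped /allP s_placed t1_ok /andP[/allP flo_ok t2_ok].
  have p_loc : p \in located s := map_f fst p_cyc.
  have loc_lt i : i \in located s -> i < nv s := scoped_located s_scoped.
  have q_lt : nxt s p < nv s by rewrite loc_lt // mem_next.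
  have pq_path := gap_path V p_loc.
  (* In a nonempty gap, [u] is the vertex next to the end [r]: the first one if [d] holds, the last
     one otherwise. *)
  have [Pp|[r1 [u [r2 [Pp r1P r2P ru]]]]] : P p = [::] \/ exists r1 u r2,
      [/\ P p = r1 ++ u :: r2, d -> r1 = [::], ~~ d -> r2 = [::] & adj (rho r) u].
    have [->|/eqP Pp] := eqVneq (P p) [::]; [by left | right].
    rewrite /r; case: (d); case/lastP: (P p) Pp pq_path => // l u _.
      by case: l => [|u' l] /= /andP[pu _]; [exists [::], u, [::] | exists [::], u', (rcons l u)].
    rewrite rcons_path last_rcons => /andP[_ uq].
    by exists l, u, [::]; rewrite cats1 adjC.
  - move: pq_path; rewrite Pp /= andbT => pq.
    case/orP: t1_ok => [/(nonadjP V)/(_ (loc_lt _ p_loc) q_lt)|]; first by rewrite pq.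
    exact: IH1 (valid_close_gap V p_loc Pp).
  have r_lt : r < nv s by rewrite /r; case: (d) => //; apply: loc_lt.
  have uP : u \in P p by rewrite Pp mem_cat mem_head orbT.
  have u_c : u \in c := gap_mem V p_loc uP.
  have [/namedP[w w_lt uE]|u_new] := boolP (u \in named rho s).
    rewrite uE in Pp ru uP u_c.
    have w_loc := gap_notin_located V p_loc uP.
    have := s_placed w; rewrite mem_iota => /(_ w_lt); rewrite (negPf w_loc) orbF.
    case/orP=> [/(voff V)|/flo_ok]; first by rewrite u_c.
    case/orP=> [/(nonadjP V)/(_ r_lt w_lt)|]; first by rewrite ru.
    by apply: (IHf _ _ _ _ (valid_insert V p_cyc Pp w_loc _ _)); rewrite ?negbK.
  case/orP: t2_ok => [/(settledP V)/(_ ru)|]; first by rewrite (negPf u_new).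
  (* The list is empty because [insert] records the adjacency of [u] to [r]. *)
  have V' := valid_add_vertex (L := [::]) V s_scoped u_new u_c (fun _ => _).
  apply: (IH2 _ _ _ (valid_insert (r1 := r1) (r2 := r2) (V' _) p_cyc _ _ _ _)) => //.
  - by rewrite eqxx.
  - by apply/negP=> /loc_lt; rewrite ltnn.
  by rewrite negbK.
- case/and4P=> w_flo w_loc s_scoped /allP gaps_ok.
  have w_lt : w < nv s by case/and5P: s_scoped => _ _ _ /allP/(_ w w_flo).
  have [[p g] p_cyc /= [wp|wP]] := mem_cyc V (vflo V w_flo).
    have p_loc : p \in located s := map_f fst p_cyc.
    have wp' : w = p by apply: (vinj V); rewrite // inE scoped_located.
    by rewrite wp' p_loc in w_loc.
  have := gaps_ok _ p_cyc; case: g p_cyc => p_cyc; last by rewrite (vgap V p_cyc) in wP.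
  case/splitPr Pp: _ / wP => [r1 r2].
  exact: (IHf _ _ _ _ (valid_insert V p_cyc Pp w_loc _ _)).
case/and5P=> s_scoped v_lt r1 r2 r3.
have [/forallP v_full|] := boolP [forall u, adj (rho v) u ==> (u \in named rho s)].
  by apply: (IH3 _ _ _ (valid_close_nbhd V _) r3) => u vu; apply: (implyP (v_full u)).
rewrite negb_forall => /existsP[u]; rewrite negb_imply => /andP[vu u_new].
have Lu : {in [:: v], forall i, (i < nv s) && adj (rho i) u}.
  by move=> i; rewrite inE => /eqP->; rewrite v_lt.
have V' := valid_add_vertex V s_scoped u_new (erefl _) Lu.
by case: (u \in c) V' => V'; [apply: IH2 V' r2 | apply: IH1 V' r1].
Qed.
End Soundness.

(** * The case distinction *)

(* The vertices 0, 1, 2, 3 are v, its predecessor and its successor on C, and x. *)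
Definition cases :=
  Case 3 1 (Ham [:: 3; 0; 2; 1]) (
  Case 3 2 (Ham [:: 3; 0; 1; 2]) (
  Meet 0 3 1 none (Ham [:: 4; 0; 2; 1]) (
  Loc 4 (
  alt 2
   (Case 2 1
     (Step false 2 (Ham [:: 3; 0; 2; 1; 4]) none (
      Case 5 0 (Ham [:: 3; 0; 5; 2; 1; 4]) (
      Case 5 1 (Ham [:: 3; 0; 2; 5; 1; 4]) (
      Case 5 3 (Ham [:: 3; 0; 4; 1; 2; 5]) (
      Step true 4 (Ham [:: 3; 0; 1; 2; 5; 4]) none (
      Case 6 0 (Ham [:: 3; 0; 6; 1; 2; 5; 4]) (
      Case 6 3 (Ham [:: 3; 0; 2; 5; 4; 1; 6]) (
      Case 6 5 (Ham [:: 3; 0; 2; 5; 6; 1; 4]) (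
      Meet 4 6 3 none (Ham [:: 7; 4; 5; 2; 0; 1; 6]) (
      Meet 4 5 0 (alt 7 (Case 7 1 (Twins 7 4) (Apart 4 5 1)) none) dead
       dead)))))))))) (
    Step false 2
     (Step true 4
       (Full 2
         (Case 5 0 (Ham [:: 5; 0; 1; 4; 2]) (
          Case 5 4 (Ham [:: 5; 2; 0; 1; 4]) (
          Meet 2 5 0 none (Ham [:: 6; 0; 1; 4; 2]) (Loc 6 none))))
         (Loc 5 none) (
        Full 4
         (Case 5 1 (Ham [:: 5; 1; 0; 2; 4]) (
          Meet 4 5 2
           (alt 0
             (Full 0
               (Case 6 1 (Ham [:: 6; 0; 2; 4; 1]) (
                Case 6 4 (Twins 4 0) (Apart 0 6 1)))
               (Case 6 4 (Twins 4 0) (Apart 0 6 2)) (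
              Full 4 (Apart 4 6 2) (Apart 4 6 2) (
              Full 1 (Apart 1 6 0) (Apart 1 6 0) (Strip 4 0 1 2 [:: 1; 2]))))
             none)
           dead dead))
         (Loc 5 none) (
        Full 0 (Apart 0 5 2) (Apart 0 5 2) (
        Full 1 (Apart 1 5 0) (Apart 1 5 0) (Strip 4 0 1 2 [:: 1; 2])))))
       none (
      Case 5 2 (Ham [:: 3; 0; 1; 5; 2; 4]) (
      Case 5 3 (Ham [:: 3; 0; 2; 4; 1; 5]) (
      Case 5 1
       (Case 5 0
         (Full 4
           (Case 6 0 (Twins 4 0) (
            Case 6 2 (Ham [:: 6; 2; 0; 1; 5; 4]) (Apart 4 6 2)))
           (Case 6 0 (Twins 4 0) (
            Case 6 3
             (Case 6 2
               (Loc 6 (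
                alt 5
                 (Step true 6 (Ham [:: 3; 0; 1; 5; 6; 2; 4]) none (
                  Case 7 2 (Ham [:: 3; 0; 1; 7; 2; 4; 5; 6]) (
                  Case 7 3 (Ham [:: 3; 0; 2; 4; 6; 5; 1; 7]) (
                  Case 7 5 (Ham [:: 3; 0; 1; 7; 5; 6; 2; 4]) (
                  Step false 5 (Ham [:: 3; 0; 2; 4; 5; 1; 7; 6]) none (
                  Case 6 5 (Apart 6 7 4) (
                  Case 8 1 (Ham [:: 3; 0; 2; 4; 5; 8; 1; 7; 6]) (
                  Case 8 2 (Ham [:: 3; 0; 1; 7; 6; 2; 8; 5; 4]) (
                  Case 8 3 (Ham [:: 3; 0; 1; 7; 6; 2; 4; 5; 8]) (
                  Apart 6 8 4))))))))))
                 none)) (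
              Apart 4 6 2)) (
            Apart 4 6 3))) (
          Full 2 (Case 6 0 (Ham [:: 6; 0; 1; 5; 4; 2]) (Apart 2 6 4))
           (Full 0 (Apart 2 6 4) (Apart 2 6 4) (
            Full 2 (Apart 2 7 4) (Apart 2 7 4) (
            Full 6 (Apart 6 7 2) (Apart 6 7 2) (
            Loc 6 (
            alt 5 (Step false 5 (Ham [:: 3; 0; 2; 6; 1; 5; 4]) none dead)
             none))))) (
          Full 0 (Apart 0 6 2) (Apart 0 6 2) (
          Full 3 (Apart 3 6 0) (Apart 3 6 0) (Strip 4 0 2 3 [:: 2; 3]))))) (
        Meet 4 5 3 none (Ham [:: 6; 4; 2; 0; 1; 5]) (
        Meet 4 5 2
         (alt 6
           (Loc 6 (
            alt 5
             (Step true 6 (Ham [:: 3; 0; 1; 5; 6; 2; 4]) none (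
              Case 7 0 (Ham [:: 3; 0; 7; 1; 5; 6; 2; 4]) (
              Case 7 2 (Ham [:: 3; 0; 1; 7; 2; 4; 5; 6]) (
              Case 7 3 (Ham [:: 3; 0; 2; 4; 6; 5; 1; 7]) (
              Case 7 5 (Ham [:: 3; 0; 1; 7; 5; 6; 2; 4]) (
              Full 6 (Apart 6 7 4) (Apart 6 7 4) (Apart 6 7 2)))))))
             none))
           none)
         dead dead))) (
      Step false 5 dead none (
      Case 5 0
       (Case 6 0
         (Case 6 4 (Twins 4 0) (
          Case 6 3
           (Case 6 5
             (Step false 5
               (Case 6 2
                 (Full 6
                   (Case 7 1 (Ham [:: 7; 1; 0; 2; 4; 5; 6]) (Apart 6 7 1))
                   (Loc 7 none) (
                  Full 1 (Apart 1 7 6) (Apart 1 7 6) (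
                  Full 2 (Apart 2 7 6) (Apart 2 7 6) (
                  Full 3 (Apart 3 7 6) (Apart 3 7 6) (
                  Full 4 (Apart 4 7 1) (Apart 4 7 1) (
                  Full 5 (Apart 5 7 0) (Apart 5 7 0) (
                  Iso [:: 4; 6; 1; 2; 3; 5; 0]))))))) (
                Apart 0 6 2))
               none (
              Case 7 1 (Ham [:: 3; 0; 2; 4; 1; 7; 5; 6]) (
              Full 6 (Apart 0 6 2) (Apart 0 6 2) (Apart 6 7 1)))) (
            Apart 0 6 5)) (
          Apart 0 6 3))) (
        Case 6 4
         (Case 6 2
           (Case 6 3
             (Case 6 5
               (Step false 5
                 (Full 0
                   (Case 7 1 (Ham [:: 7; 0; 2; 4; 5; 6; 1]) (Apart 0 7 1))
                   (Loc 7 none) (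
                  Full 1 (Apart 1 7 0) (Apart 1 7 0) (
                  Full 2 (Apart 2 7 0) (Apart 2 7 0) (
                  Full 3 (Apart 3 7 0) (Apart 3 7 0) (
                  Full 5 (Apart 5 7 0) (Apart 5 7 0) (
                  Full 6 (Apart 6 7 1) (Apart 6 7 1) (
                  Iso [:: 0; 6; 1; 2; 3; 5; 4])))))))
                 none (
                Case 7 1 (Ham [:: 3; 0; 1; 7; 5; 4; 2; 6]) (Apart 6 7 1))) (
              Apart 4 6 5)) (
            Apart 4 6 3)) (
          Apart 4 6 2)) (
        Meet 1 6 0 none (Ham [:: 7; 0; 2; 4; 5; 6; 1]) (
        Case 7 4 (Twins 4 0) (
        Case 7 3
         (Case 7 2
           (Full 7 (Apart 0 7 5) (Apart 0 7 5) (
            Full 5 (Case 8 4 (Ham [:: 8; 4; 2; 0; 1; 6; 5]) (Apart 5 8 0))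
             (Full 4 (Apart 5 8 0) (Apart 5 8 0) (
              Full 5 (Apart 5 9 0) (Apart 5 9 0) (
              Full 1 (Apart 1 9 0) (Apart 1 9 0) (
              Full 2 (Apart 2 9 0) (Apart 2 9 0) (
              Full 3 (Apart 3 9 0) (Apart 3 9 0) (
              Full 6 (Apart 6 9 7) (Apart 6 9 7) (
              Case 6 2
               (Step false 5 (Loc 7 none)
                 (alt 7 (Ham [:: 3; 0; 1; 6; 2; 4; 5; 7]) (
                  alt 8
                   (Case 8 1 (Ham [:: 3; 0; 2; 6; 1; 8; 5; 4]) (Apart 1 6 4))
                   none))
                 dead) (
              Apart 7 6 2)))))))) (
            Case 6 5 (Apart 5 6 4) (Case 7 5 (Apart 7 6 5) (Apart 0 7 5))))) (
          Apart 0 7 2)) (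
        Apart 0 7 3)))))) (
      Case 6 0
       (Meet 4 5 2 (alt 6 (Case 6 3 (Twins 6 4) (Apart 4 5 3)) none)
         (Ham [:: 7; 2; 0; 1; 6; 5; 4]) (
        Case 7 1
         (Meet 4 5 0 (alt 7 (Case 7 3 (Twins 7 4) (Apart 4 5 3)) none) dead
           dead) (
        Apart 4 5 1))) (
      Case 6 4 (Apart 4 5 0) (
      Meet 4 5 3 none (Ham [:: 7; 4; 2; 0; 1; 6; 5]) (
      Meet 1 6 4 (alt 7 (Case 7 0 (Apart 4 5 2) (Apart 4 5 0)) none) dead
       dead))))))))))
     none (
    Case 5 1 (Ham [:: 3; 0; 2; 5; 1; 4]) (
    Case 5 3 (Ham [:: 3; 4; 1; 0; 2; 5]) (
    Case 5 0
     (Case 4 2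
       (Step true 4
         (Full 0
           (Case 6 1 (Ham [:: 6; 0; 2; 5; 4; 1]) (
            Case 6 4 (Twins 4 0) (Apart 0 6 1)))
           (Case 6 4 (Twins 4 0) (
            Case 6 1
             (Case 6 3
               (Loc 6 (
                alt 2
                 (Case 6 2
                   (Step true 6
                     (Case 5 2 (Ham [:: 3; 0; 1; 4; 5; 2; 6]) (
                      Step false 2
                       (Full 4
                         (Case 7 1 (Ham [:: 7; 1; 0; 2; 6; 5; 4]) (
                          Apart 4 7 1))
                         (Loc 7 none) (
                        Full 1 (Apart 1 7 4) (Apart 1 7 4) (
                        Full 2 (Apart 2 7 4) (Apart 2 7 4) (
                        Full 3 (Apart 3 7 4) (Apart 3 7 4) (
                        Full 5 (Apart 5 7 4) (Apart 5 7 4) (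
                        Full 6 (Apart 6 7 0) (Apart 6 7 0) (
                        Iso [:: 4; 6; 1; 2; 3; 5; 0])))))))
                       none (
                      Case 7 1 (Ham [:: 3; 0; 1; 7; 2; 4; 5; 6]) (
                      Apart 6 7 1))))
                     none (
                    Case 7 1 (Ham [:: 3; 0; 1; 7; 5; 4; 2; 6]) (
                    Case 7 2 (Ham [:: 3; 0; 1; 4; 5; 7; 2; 6]) (
                    Case 7 3 (Ham [:: 3; 0; 1; 6; 2; 4; 5; 7]) (
                    Full 6 (Apart 6 7 0) (Apart 6 7 0) (Apart 6 7 1)))))) (
                  Step false 2 dead none (
                  Case 7 1 (Ham [:: 3; 0; 1; 7; 2; 4; 5; 6]) (
                  Case 7 3 (Ham [:: 3; 0; 1; 6; 5; 4; 2; 7]) (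
                  Case 7 5 (Ham [:: 3; 0; 1; 4; 2; 7; 5; 6]) (
                  Apart 6 7 0))))))
                 none)) (
              Apart 0 6 3)) (
            Apart 0 6 1))) (
          Full 1 (Case 6 4 (Ham [:: 6; 1; 0; 2; 5; 4]) (Apart 1 6 0))
           (Full 4 (Apart 1 6 0) (Apart 1 6 0) (
            Full 1 (Apart 1 7 0) (Apart 1 7 0) (
            Full 3 (Apart 3 7 0) (Apart 3 7 0) (
            Full 6 (Apart 6 7 1) (Apart 6 7 1) (
            Meet 1 6 0
             (alt 4
               (Loc 6 (
                alt 2
                 (Step true 6
                   (Case 5 2 (Ham [:: 3; 0; 1; 6; 2; 5; 4]) (
                    Full 2 (Apart 2 7 0) (Apart 2 7 0) (
                    Full 5 (Apart 5 7 0) (Apart 5 7 0) (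
                    Case 6 3
                     (Step false 2 (Iso [:: 0; 6; 1; 2; 3; 5; 4]) none dead) (
                    Apart 4 6 3)))))
                   none dead)
                 none))
               none)
             dead dead))))) (
          Full 4 (Apart 4 6 1) (Apart 4 6 1) (
          Full 3 (Apart 3 6 0) (Apart 3 6 0) (Strip 4 0 1 3 [:: 1; 3])))))
         none (
        Case 6 0 (Twins 4 0) (
        Case 6 3 (Ham [:: 3; 0; 2; 5; 4; 1; 6]) (Apart 4 6 3)))) (
      Meet 0 3 2 none (Ham [:: 6; 0; 1; 4; 5; 2]) (
      Case 6 1
       (Case 6 5
         (Case 6 4 (Twins 6 0) (
          Case 5 2
           (Loc 6 (
            alt 2
             (Step false 2 (Ham [:: 3; 0; 2; 5; 6; 1; 4]) none (
              Case 7 1 (Ham [:: 3; 0; 2; 7; 1; 4; 5; 6]) (Apart 6 7 1))) (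
            alt 4
             (Step false 4 dead none (
              Case 7 1 (Ham [:: 3; 0; 2; 5; 4; 7; 1; 6]) (Apart 6 7 1)))
             none))) (
          Apart 0 4 2))) (
        Case 5 2
         (Case 6 4
           (Step true 4
             (Loc 6 (
              alt 2
               (Step false 2 (Ham [:: 3; 0; 2; 5; 6; 1; 4]) none (
                Case 7 1 (Ham [:: 3; 0; 1; 7; 2; 5; 6; 4]) (
                Case 7 4 (Ham [:: 3; 0; 1; 4; 7; 2; 5; 6]) (Apart 6 7 1))))
               none))
             (alt 6 (Ham [:: 3; 0; 1; 6; 2; 5; 4]) none) (
            Case 7 5 (Ham [:: 3; 0; 2; 5; 7; 1; 4]) (Apart 4 7 5))) (
          Loc 6 (
          alt 2
           (Step true 6 dead none (
            Case 7 1 (Ham [:: 3; 0; 4; 1; 7; 5; 2; 6]) (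
            Case 7 2 (Ham [:: 3; 0; 1; 4; 5; 7; 2; 6]) (
            Case 7 3 (Ham [:: 3; 0; 2; 6; 1; 4; 5; 7]) (Apart 6 7 0))))) (
          alt 4
           (Step false 4 dead none (
            Case 7 1 (Ham [:: 3; 0; 2; 5; 4; 7; 1; 6]) (
            Case 7 2 (Ham [:: 3; 0; 5; 2; 7; 4; 1; 6]) (
            Case 7 3 (Ham [:: 3; 0; 1; 6; 2; 5; 4; 7]) (Apart 6 7 0)))))
           none)))) (
        Apart 0 5 2))) (
      Apart 0 2 1)))) (
    Meet 4 5 3 none (Ham [:: 6; 4; 1; 0; 2; 5]) (
    Case 6 1
     (Case 6 0
       (Step true 4
         (Loc 6 (
          alt 2
           (Step false 2
             (Case 4 2 (Twins 6 4) (
              Case 5 2 (Ham [:: 3; 0; 2; 5; 6; 1; 4]) (Apart 6 5 2)))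
             none (
            Case 7 4 (Twins 6 4) (
            Case 7 5 (Ham [:: 3; 0; 2; 7; 5; 6; 1; 4]) (Apart 6 7 5))))
           none))
         (alt 6 (Ham [:: 3; 0; 2; 5; 4; 1; 6]) none) (
        Case 7 5 (Ham [:: 3; 0; 2; 5; 7; 1; 4]) (
        Case 7 6 (Twins 6 4) (Apart 4 7 5)))) (
      Step true 4
       (Loc 6 (
        alt 2
         (Case 4 2
           (Step false 2
             (Case 5 2 (Ham [:: 3; 0; 1; 4; 2; 5; 6]) (Apart 4 5 0)) none (
            Case 7 1 (Ham [:: 3; 0; 1; 7; 2; 4; 5; 6]) (
            Case 7 3 (Ham [:: 3; 0; 1; 6; 5; 4; 2; 7]) (
            Case 7 5 (Ham [:: 3; 0; 1; 4; 2; 7; 5; 6]) (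
            Full 6 (Apart 6 7 4) (Apart 6 7 4) (Apart 6 7 1)))))) (
          Meet 0 4 2 none (Ham [:: 7; 0; 1; 4; 5; 6; 2]) (
          Case 7 5
           (Case 7 6
             (Step false 2 (Case 7 1 (Apart 6 3 2) (Apart 6 2 1))
               (alt 7 (Ham [:: 3; 0; 2; 7; 5; 6; 1; 4]) none) (
              Case 8 1 (Ham [:: 3; 0; 2; 8; 1; 4; 5; 6]) (
              Case 8 7 (Apart 6 8 1) (Apart 6 8 1)))) (
            Step false 2
             (Case 5 2 (Ham [:: 3; 0; 2; 5; 6; 1; 4]) (Apart 6 4 2)) none (
            Case 8 1 (Ham [:: 3; 0; 2; 8; 1; 4; 5; 6]) (
            Case 8 3 (Ham [:: 3; 4; 5; 6; 1; 0; 2; 8]) (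
            Case 8 5 (Ham [:: 3; 0; 2; 8; 5; 6; 1; 4]) (Apart 6 8 4)))))) (
          Apart 4 5 0))))
         none))
       (alt 6 (Ham [:: 3; 0; 2; 5; 4; 1; 6]) none) (
      Case 7 2 (Ham [:: 3; 0; 1; 7; 2; 5; 4]) (Apart 0 4 2)))) (
    Step true 4
     (Loc 6 (
      alt 2
       (Full 4 (Case 7 1 (Ham [:: 7; 1; 0; 2; 6; 5; 4]) (Apart 4 5 1))
         (Meet 4 5 1
           (alt 7
             (Meet 0 4 2
               (alt 6
                 (Step false 2
                   (Case 5 2 (Ham [:: 3; 4; 1; 0; 2; 5; 6]) (
                    Step true 6 (Loc 7 none)
                     (alt 7 (Ham [:: 3; 0; 2; 6; 5; 7; 1; 4]) none) (
                    Case 8 2 (Ham [:: 3; 0; 1; 4; 5; 8; 2; 6]) (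
                    Apart 6 5 2))))
                   (alt 7 (Ham [:: 3; 0; 1; 7; 2; 6; 5; 4]) none) (
                  Case 8 1 (Ham [:: 3; 0; 1; 8; 2; 6; 5; 4]) (
                  Case 8 3 (Ham [:: 3; 0; 1; 4; 5; 6; 2; 8]) (
                  Full 0 (Apart 6 8 3) (Apart 6 8 3) (
                  Case 7 0 (Apart 6 8 3) (Apart 0 2 1)))))) (
                alt 7
                 (Case 7 3
                   (Full 0 (Apart 4 6 1) (Apart 4 6 1) (
                    Full 3 (Apart 3 8 7) (Apart 3 8 7) (
                    Full 6 (Apart 6 8 3) (Apart 6 8 3) (
                    Step false 2
                     (Case 5 2 (Ham [:: 3; 4; 1; 0; 2; 5; 6]) (Apart 6 5 2))
                     none dead)))) (
                  Step false 2
                   (Case 5 2 (Ham [:: 3; 4; 1; 0; 2; 5; 6]) (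
                    Step true 6 (Loc 7 none)
                     (alt 7 (Ham [:: 3; 0; 1; 4; 5; 7; 2; 6]) none) (
                    Case 8 2 (Ham [:: 3; 0; 1; 4; 5; 8; 2; 6]) (
                    Full 6 (Apart 4 6 1) (Apart 4 6 1) (
                    Case 6 0 (Apart 6 5 2) (Apart 6 3 2))))))
                   (alt 7 (Ham [:: 3; 0; 2; 7; 1; 4; 5; 6]) none) (
                  Case 8 3 (Ham [:: 3; 6; 5; 4; 1; 0; 2; 8]) (
                  Case 8 5 (Ham [:: 3; 4; 1; 0; 2; 8; 5; 6]) (
                  Case 8 0 (Apart 0 3 2) (
                  Case 8 7 (Apart 6 8 4) (Apart 6 8 4)))))))
                 none))
               dead dead)
             none)
           dead dead) (
        Apart 4 5 1))
       none))
     (alt 6 (Ham [:: 3; 0; 2; 5; 4; 1; 6]) none) (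
    Case 7 5 (Ham [:: 3; 0; 2; 5; 7; 1; 4]) (Apart 4 5 1))))))))))
   none)))).

Lemma cases_refute : refutes cases start.
Proof. by vm_compute. Qed.

(** * Initial configuration and conclusion *)

Lemma start_valid (G : sgraph) (c : seq G) :
  connected G -> is_cycle c -> ~ hamiltonian c ->
  exists rho P, valid c rho P start.
Proof.
move=> Gconn [/andP[c_path c_uniq] c_size] c_ham.
have [v [x [v_c x_c vx]]] : exists v x, [/\ v \in c, x \notin c & adj v x].
  have [/existsP[v /andP[v_c /existsP[x /andP[vx x_c]]]]|no] :=
    boolP [exists v in c, [exists x, adj v x && (x \notin c)]]; first by exists v, x.
  case: c_ham => y; have [z z_c] : exists z, z \in c.
    by case: (c) c_size => // z l _; exists z; apply: mem_head.
  suff: y \in [set u | u \in c] by rewrite inE.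
  apply: (closed_set_full Gconn (x := z)) => [|u w]; rewrite !inE // => u_c uw.
  apply: contraNT no => w_c; apply/existsP; exists u; rewrite u_c /=.
  by apply/existsP; exists w; rewrite uw.
have [i l lE] := rot_to v_c.
have l_perm : perm_eq (v :: l) c by rewrite -lE perm_rot.
have l_cycle : cycle (@adj G) (v :: l) by rewrite -lE rot_cycle.
have := perm_size l_perm; case: l lE l_perm l_cycle => [|a l] lE l_perm l_cycle /=.
  by move=> cE; rewrite -cE in c_size.
case/lastP: l lE l_perm l_cycle => [|m b] lE l_perm l_cycle cE.
  by rewrite -cE in c_size.
(* The cycle reads [v], [a], [m], [b]: the successor [a] of [v] gets the name 2 and the predecessor
   [b] the name 1, and the only gap of [start], after 2, is [m]. *)
pose rho := nth v [:: v; b; a; x]; pose P i := if i == 2 then m else [::].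
have flatE : flat rho P (cyc start) = v :: a :: rcons m b.
  by rewrite /flat /rho /P /= cats1.
exists rho, P; split; rewrite ?flatE //.
- have rho_uniq : uniq [:: v; b; a; x].
    have in_c u : u \in v :: a :: rcons m b -> x != u.
      by rewrite (perm_mem l_perm); apply: contraTneq => <-.
    have := perm_uniq l_perm; rewrite c_uniq /= !inE !mem_rcons !inE !negb_or.
    case/and3P=> /and3P[va vb _] /andP[ab _] _; rewrite va vb (eq_sym b) ab.
    by rewrite !(eq_sym _ x) !in_c // !inE ?mem_rcons ?inE ?eqxx ?orbT.
  by move=> j k jlt klt /eqP; rewrite nth_uniq // => /eqP.
- move=> j k e; rewrite !inE => /or3P[]/eqP[-> -> ->]; rewrite /rho //=.
    move: l_cycle; rewrite /= rcons_path last_rcons => /andP[_ /andP[_]].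
    by rewrite adjC.
  by case/andP: l_cycle.
- by move=> j; rewrite !inE => /or3P[]/eqP[->].
by move=> j; rewrite inE => /eqP->.
Qed.

(** Makes isomorphism decidable, with bijectivity tested as injectivity and a cardinality bound.
    [refutes_sound] gives its alternative for one cycle at a time, whereas the theorem must choose a
    side before the cycle is given. *)
Lemma isomorphicP (H K : sgraph) : reflect (isomorphic H K)
  [exists f : {ffun H -> K}, [&& injectiveb f, #|K| <= #|H|
     & [forall x, forall y, adj (f x) (f y) == adj x y]]].
Proof.
apply: (iffP existsP) => [[f /and3P[/injectiveP f_inj KH /forallP f_adj]]|].
  exists f; split=> [|x y]; first exact: inj_card_bij.
  by apply/eqP; have /forallP := f_adj x.
case=> f [f_bij f_adj]; exists [ffun x => f x]; apply/and3P; split.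
- by apply/injectiveP=> x y; rewrite !ffunE; apply: bij_inj f_bij _ _.
- by rewrite (bij_eq_card f_bij).
by apply/forallP=> x; apply/forallP=> y; rewrite !ffunE f_adj.
Qed.

Theorem theorem2 (G : sgraph)
    (Gconn : connected G)
    (Gloc : locally_isometric G)
    (Gmax : max_deg G = 6)
    (Gtwins : ~ exists u v : G, [/\ true_twins u v, deg u = 6 & deg v = 6]) :
  fully_cycle_extendable G \/
  isomorphic G (join (complete_bipartite 2 4) (complete 1)).
Proof.
have G_triangle := mem_triangle Gconn Gloc; rewrite Gmax in G_triangle.
have [iso|no_iso] := isomorphicP G K24_K1; [by right | left].
split=> [c c_cycle c_ham|]; last exact: G_triangle.
have [rho [P V]] := start_valid Gconn c_cycle c_ham.
by case: (refutes_sound Gconn Gloc Gmax Gtwins c_cycle V cases_refute).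
Qed.
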